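(* Let $W$ be a Coxeter group with simple generators $S$. For any orientation $\Omega$ of the Coxeter diagram $\Gamma$ of $W$ and any $w\in W$, let $L(w,\Omega)$ be the collection of subsets $J$ of $S$ such that $J$ is $\Omega$-acyclic and $c(\Omega,J)\le w$ in the weak order. Then $L(w,\Omega)$ is an antimatroid (on the ground set $S$).
   Context: $W$ is a Coxeter group with finite set $S$ of simple generators; $\ell$ is the length function and $e$ the identity. The (right) weak order on $W$ sets $u\le w$ if and only if $\ell(u)+\ell(u^{-1}w)=\ell(w)$. The Coxeter diagram $\Gamma$ is the graph with vertex set $S$ in which distinct $s,t$ are joined by an edge if and only if they do not commute. $\Omega$ is an arbitrary orientation of $\Gamma$ (each edge is given one direction; directed cycles are allowed). A subset $J\subseteq S$ is $\Omega$-acyclic if the induced subgraph of $\Gamma$ on $J$, oriented by $\Omega$, has no directed cycle. For $\Omega$-acyclic $J$, $c(\Omega,J)=s_1s_2\cdots s_k$, where $s_1,\ldots,s_k$ is any ordering of $J$ such that $i<j$ whenever there is an edge oriented $s_j\to s_i$ (the product does not depend on the ordering; $c(\Omega,\emptyset)=e$). A collection $\mathcal{L}$ of subsets of a finite set $E$ is an antimatroid if (1) $\emptyset\in\mathcal{L}$; and (2) if $Y,Z\in\mathcal{L}$ and $Z\not\subseteq Y$, then there is an $x\in Z\setminus Y$ such that $Y\cup\{x\}\in\mathcal{L}$. *)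

(* Defs.v *)
From HB Require Import structures.
From mathcomp Require Import all_boot.

Set Implicit Arguments.
Unset Strict Implicit.
Unset Printing Implicit Defensive.

Local Open Scope group_scope.

(* The pair (W, S) is given by the presentation
   < S | (s t)^(m s t) = 1 >, i.e. by the universal property of that
   presentation. The value [coxmat s t = 0] encodes m(s, t) = infinity: the
   corresponding relation is then vacuous. As the generators are involutions,
   generation needs no inverse letters. *)
Record coxeterSystem (W : groupType) (S : finType) := CoxeterSystem {
  gen : S -> W;
  coxmat : S -> S -> nat;
  coxmat_sym : forall s t, coxmat s t = coxmat t s;
  coxmat_eq1 : forall s t, (coxmat s t == 1)%N = (s == t);
  gen_rel : forall s t, (gen s * gen t) ^+ coxmat s t = 1;
  gen_full : forall w : W, exists u : seq S, w = \prod_(s <- u) gen s;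
  gen_univ : forall (G : groupType) (f : S -> G),
    (forall s t, (f s * f t) ^+ coxmat s t = 1) ->
    exists phi : {multiplicative W -> G}, forall s, phi (gen s) = f s
}.

Lemma ex_word (W : groupType) (S : finType) (C : coxeterSystem W S) (w : W) :
  exists n, [exists u : n.-tuple S, w == \prod_(s <- u) gen C s].
Proof.
have [u ->] := gen_full C w.
by exists (size u); apply/existsP; exists (in_tuple u).
Qed.

Definition cox_length (W : groupType) (S : finType) (C : coxeterSystem W S)
  (w : W) : nat := ex_minn (ex_word C w).

Definition weak_le (W : groupType) (S : finType) (C : coxeterSystem W S) :
    rel W :=
  fun u w => (cox_length C u + cox_length C (u^-1 * w) == cox_length C w)%N.

Definition diagram (W : groupType) (S : finType) (C : coxeterSystem W S) :
    rel S :=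
  fun s t => (s != t) && (gen C s * gen C t != gen C t * gen C s).

(* [Om s t] means that the edge {s, t} is oriented s -> t. *)
Definition orientation (T : finType) (e Om : rel T) : Prop :=
  (forall s t, Om s t -> e s t) /\ (forall s t, e s t -> Om s t (+) Om t s).

Definition acyclic (T : finType) (Om : rel T) (J : {set T}) : Prop :=
  forall p : seq T, p != [::] -> {subset p <= J} -> ~ ucycle Om p.

(* u lists J, and the target of each arrow inside J precedes its source. *)
Definition admissible (T : finType) (Om : rel T) (J : {set T}) (u : seq T) :
    bool :=
  perm_eq u (enum J) &&
  [forall s in J, forall t in J, Om s t ==> (index t u < index s u)%N].

(* The default [::] is never reached on acyclic sets (admissible_ex), and the
   choice of the admissible ordering is immaterial (cox_elt_indep). *)
Definition cox_elt (W : groupType) (S : finType) (C : coxeterSystem W S)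
    (Om : rel S) (J : {set S}) : W :=
  \prod_(s <- head [::] [seq u <- permutations (enum J) | admissible Om J u])
    gen C s.

Definition initial_sets (W : groupType) (S : finType) (C : coxeterSystem W S)
    (w : W) (Om : rel S) : {set S} -> Prop :=
  fun J => acyclic Om J /\ weak_le C (cox_elt C Om J) w.

Definition antimatroid (E : finType) (L : {set E} -> Prop) : Prop :=
  L set0 /\
  forall Y Z : {set E}, L Y -> L Z -> ~~ (Z \subset Y) ->
    exists2 x, x \in Z :\: Y & L (x |: Y).

Lemma sink_ex (T : finType) (Om : rel T) (J : {set T}) :
  acyclic Om J -> J != set0 ->
  exists2 t, t \in J & forall s, s \in J -> ~~ Om t s.
Proof.
move=> acJ /set0Pn[x0 Jx0].
case: (pickP [pred t in J | [forall s in J, ~~ Om t s]]) => [t /andP[Jt] | no].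
  by move/forall_inP; exists t.
pose f t := odflt t [pick s in J | Om t s].
have fP t : t \in J -> f t \in J /\ Om t (f t).
  move=> Jt; rewrite /f; case: pickP => [s /andP[//]|nos].
  have /negP[] := negbT (no t); rewrite /= Jt; apply/forall_inP=> s Js.
  by have /= := nos s; rewrite Js /= => ->.
have itJ n x : x \in J -> iter n f x \in J.
  by move=> Jx; elim: n => //= n /fP[].
have : ~~ uniq (traject f x0 #|T|.+1).
  by apply/negP=> /card_uniqP; rewrite size_traject => e;
     have := max_card [in traject f x0 #|T|.+1]; rewrite e ltnn.
rewrite looping_uniq negbK.
move=> /trajectP[i lti e].
pose y := iter i f x0; pose k := (#|T| - i).-1.
have Jy : y \in J by apply: itJ.
have ey : iter k.+1 f y = y.
  by rewrite /y -iterD /k prednK ?subn_gt0 // subnK ?e // ltnW.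
have cyc : fcycle f (orbit f y).
  by apply/(orbitPcycle 3 0); exists k.
have sJ : {subset orbit f y <= J}.
  by move=> z; rewrite -fconnect_orbit => /iter_findex <-; apply: itJ.
case: (acJ (orbit f y)) => //.
  by rewrite -size_eq0 size_orbit -lt0n order_gt0.
rewrite /ucycle /ucycleb orbit_uniq andbT.
apply: (sub_in_cycle (P := mem J)) cyc; last by apply/allP.
by move=> a b Ja _ /eqP <-; have [] := fP a Ja.
Qed.

Lemma admissible_ex (T : finType) (Om : rel T) (J : {set T}) :
  acyclic Om J -> exists u, admissible Om J u.
Proof.
have [n] := ubnP #|J|; elim: n J => // n IHn J leJ acJ.
have [->|J0] := eqVneq J set0.
  exists [::]; rewrite /admissible enum_set0 perm_refl /=.
  by apply/forall_inP => s; rewrite inE.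
have [t Jt sinkt] := sink_ex acJ J0.
case: (IHn (J :\ t)) => [||u /andP[pu /forall_inP ou]].
- by move: leJ; rewrite (cardsD1 t) Jt.
- by move=> p p0 sp; apply: acJ => // z /sp; rewrite inE => /andP[].
exists (t :: u); apply/andP; split.
  apply: uniq_perm => [||z]; rewrite ?enum_uniq //=.
    by rewrite (perm_uniq pu) enum_uniq (perm_mem pu) mem_enum !inE eqxx.
  rewrite inE (perm_mem pu) !mem_enum !inE.
  by case: eqVneq => // ->.
apply/forall_inP=> a Ja; apply/forall_inP=> b Jb; apply/implyP=> ab.
have ta : t != a by apply: contraTneq ab => <-; apply: sinkt.
rewrite /= (negPf ta); case: eqVneq => // tb; rewrite ltnS.
have aJ : a \in J :\ t by rewrite !inE eq_sym ta.
have bJ : b \in J :\ t by rewrite !inE eq_sym tb.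
by have /forall_inP/(_ b bJ)/implyP := ou a aJ; apply.
Qed.

Lemma admissible_prod (W : groupType) (S : finType) (C : coxeterSystem W S)
    (Om : rel S) (J : {set S}) (u v : seq S) :
  orientation (diagram C) Om -> admissible Om J u -> admissible Om J v ->
  \prod_(s <- u) gen C s = \prod_(s <- v) gen C s.
Proof.
move=> [_ oriP].
have adm_pw z : admissible Om J z -> pairwise (fun a b => ~~ Om a b) z.
  case/andP=> pz /forall_inP oz.
  have uz : uniq z by rewrite (perm_uniq pz) enum_uniq.
  case: z => // x z in pz oz uz *.
  apply/(pairwiseP x) => i j; rewrite !inE => ilt jlt lij.
  have inJ k : k < size (x :: z) -> nth x (x :: z) k \in J.
    by move=> kz; rewrite -mem_enum -(perm_mem pz) mem_nth.
  apply/negP=> ij.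
  have /forall_inP/(_ _ (inJ j jlt))/implyP/(_ ij) := oz _ (inJ i ilt).
  by rewrite !index_uniq // ltnNge ltnW.
move=> au av; have pu := adm_pw u au; have pv := adm_pw v av.
case/andP: au => eu _; case/andP: av => ev _.
have uu : uniq u by rewrite (perm_uniq eu) enum_uniq.
have {eu ev} : perm_eq u v by rewrite (perm_trans eu) // perm_sym.
elim: u v pu pv uu => [|x u IHu] v pu pv uu.
  by rewrite perm_sym => /perm_nilP ->.
move=> puv; have vx : x \in v by rewrite -(perm_mem puv) mem_head.
case/splitPr: vx => v1 v2 in pv puv *.
move: pu pv uu; rewrite pairwise_cat /= => /andP[xu pu].
case/and4P=> v12 pv1 xv2 pv2 /andP[nxu uu].
have puv' : perm_eq u (v1 ++ v2).
  by rewrite -(perm_cons x) (perm_trans puv) // perm_catC /= perm_cons perm_catC.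
have cx y : y \in v1 -> commute (gen C x) (gen C y).
  move=> yv1; have yu : y \in u by rewrite (perm_mem puv') mem_cat yv1.
  have nxy := allP xu y yu.
  have nyx : ~~ Om y x by have /allrelP := v12; apply=> //; rewrite mem_head.
  have xy : x != y by apply: contraNneq nxu => ->.
  apply/eqP; apply/negPn/negP=> ne.
  by have := oriP x y; rewrite /diagram xy ne (negPf nxy) (negPf nyx) => /(_ isT).
have ce : \prod_(s <- v1) gen C s * gen C x = gen C x * \prod_(s <- v1) gen C s.
  elim: v1 cx {v12 pv1 puv puv'} => [|y v1 IHv] cx.
    by rewrite big_nil mulg1 mul1g.
  rewrite !big_cons -mulgA IHv; last by move=> z zv; apply: cx; rewrite inE zv orbT.
  by rewrite !mulgA (cx y) ?mem_head.
rewrite big_cons big_cat /= big_cons mulgA ce -mulgA -big_cat /=.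
congr (_ * _); apply: IHu => //.
rewrite pairwise_cat pv1 pv2 !andbT /=.
by apply/allrelP=> a b av bv; have /allrelP := v12; apply=> //; rewrite inE bv orbT.
Qed.

Lemma cox_elt_indep (W : groupType) (S : finType) (C : coxeterSystem W S)
    (Om : rel S) (J : {set S}) (u : seq S) :
  orientation (diagram C) Om -> admissible Om J u ->
  cox_elt C Om J = \prod_(s <- u) gen C s.
Proof.
move=> oriP au; rewrite /cox_elt.
have pu : u \in [seq v <- permutations (enum J) | admissible Om J v].
  by rewrite mem_filter au mem_permutations; case/andP: au.
case E : [seq v <- _ | _] pu => [//|v r] _ /=.
apply: (admissible_prod oriP) au.
have : v \in [seq v <- permutations (enum J) | admissible Om J v].
  by rewrite E mem_head.
by rewrite mem_filter => /andP[].
Qed.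

(* Main.v *)
From HB Require Import structures.
From mathcomp Require Import all_boot all_order all_algebra.
From mathcomp Require Import ring lra zify.
From mathcomp Require Import boolp Rstruct.
From Stdlib Require Rdefinitions Rtrigo1 Cos_plus.
Require Import Defs.

(** The geometric representation turns the statement into one about cones.
W acts on a real vector space with basis the simple roots, and a generator s
is a left descent of w exactly when w^-1 makes the simple root of s negative
([descentP]). Stripping the letters of a word from the left of w, each time
through a descent, is the weak order when the letters are distinct
([weak_le_word]). It can be done exactly when w^-1 makes nonpositive a
whole convex cone attached to the word ([strip_cone], [cone_strip]).

In this form two closure properties are read off from a single reflection.
Let s be a descent of w and u a word with distinct letters below w. If s is
not a letter of u, or if some earlier letter of u is joined to s, then u is
also below s w ([strip_gen_notin], [strip_gen_in]): the reflection in s maps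
the cone of u into itself plus nonnegative multiples of the root of s.

The rest is combinatorics of the family of sets J that are initial in w.
The heart is that it is stable under adjoining to Y the one element x that a
second member Z has outside Y ([initial_setU]), by induction on the length of
w. If the union has a sink, that sink is stripped. Hence it is enough to find
some w' for which the union is initial, as this already forbids directed
cycles. Take a sink a of Z. If a lies in Y without being a sink there,
w' = a w works. If a is x, take a sink s of Y. The only interesting case is
an arrow from s to a; then the singleton of a, the pair s, a, and Y without
s are all initial in s w, and induction unites them.

The antimatroid axiom follows: in an admissible ordering of Z, take the prefix
that ends with its first letter x outside Y. It is an initial set contained in
Y with x adjoined. *)

Set Implicit Arguments.
Unset Strict Implicit.
Unset Printing Implicit Defensive.

Import Order.TTheory GRing.Theory Num.Theory.
Local Open Scope ring_scope.

Local Notation R := Rdefinitions.R.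
Local Notation sin := Rtrigo_def.sin.
Local Notation cos := Rtrigo_def.cos.
Local Notation PI := Rtrigo1.PI.

(** * Chebyshev values at the angles pi / m *)

(** The value -2 B(s, t) of the standard bilinear form when m(s, t) = m. Since
division by 0 gives 0, the value at m = 0, which encodes infinity, is 2 cos
0 = 2, and the value at m = 1 is -2, so that B(s, s) = 1. *)
Definition dihedral_coef (m : nat) : R := 2 * cos (PI / m%:R).

Fixpoint cheb_pair (k : R) (n : nat) : R * R :=
  if n is n'.+1 then let: (a, b) := cheb_pair k n' in (b, k * b - a)
  else (0, 1).
(** Chebyshev polynomials of the second kind: at k = 2 cos x the n-th value is
sin (n x) / sin x. They are the coordinates of the roots of a dihedral
group. *)
Definition cheb k n := (cheb_pair k n).1.

Lemma cheb0 k : cheb k 0 = 0. Proof. by []. Qed.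
Lemma cheb1 k : cheb k 1 = 1. Proof. by []. Qed.

Lemma chebSS k n : cheb k n.+2 = k * cheb k n.+1 - cheb k n.
Proof. by rewrite /cheb /=; case: (cheb_pair k n). Qed.

Lemma sinD (x y : R) : sin (x + y) = sin x * cos y + cos x * sin y.
Proof. by have := Rtrigo1.sin_plus x y; rewrite !RealsE. Qed.

Lemma cosD (x y : R) : cos (x + y) = cos x * cos y - sin x * sin y.
Proof. by have := Cos_plus.cos_plus x y; rewrite !RealsE. Qed.

Lemma sin_gt0 (x : R) : 0 < x -> x < PI -> 0 < sin x.
Proof. by move=> /RltP x0 /RltP xp; apply/RltP; apply: Rtrigo1.sin_gt_0. Qed.

Lemma sin_ge0 (x : R) : 0 <= x -> x <= PI -> 0 <= sin x.
Proof. by move=> /RleP x0 /RleP xp; apply/RleP; apply: Rtrigo1.sin_ge_0. Qed.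

Lemma PI_gt0 : 0 < PI.
Proof. by apply/RltP; apply: Rtrigo1.PI_RGT_0. Qed.

Lemma cheb_sin (x : R) n : sin x * cheb (2 * cos x) n = sin (n%:R * x).
Proof.
suff: sin x * cheb (2 * cos x) n = sin (n%:R * x) /\
      sin x * cheb (2 * cos x) n.+1 = sin (n.+1%:R * x) by case.
elim: n => [|n [IH1 IH2]].
  by rewrite cheb0 cheb1 mulr0 mul0r !mul1r mulr1 Rtrigo_def.sin_0.
split=> //; rewrite chebSS mulrBr IH1 mulrCA IH2.
have -> : n%:R * x = n.+1%:R * x - x by rewrite -natr1; ring.
have -> : n.+2%:R * x = n.+1%:R * x + x by rewrite -[n.+2%:R]natr1; ring.
rewrite (sinD _ (- x)) sinD.
have -> : cos (- x) = cos x by exact: Rtrigo1.cos_neg.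
have -> : sin (- x) = - sin x by have := Rtrigo1.sin_neg x; rewrite RealsE.
by ring.
Qed.

Lemma dihedral_coef0 : dihedral_coef 0 = 2.
Proof. by rewrite /dihedral_coef invr0 mulr0 Rtrigo_def.cos_0 mulr1. Qed.

Lemma sinPI : sin PI = 0.
Proof. exact: Rtrigo1.sin_PI. Qed.

Lemma cosPI : cos PI = -1.
Proof. by rewrite Rtrigo1.cos_PI; apply: (RoppE 1). Qed.

Lemma dihedral_coef1 : dihedral_coef 1 = - 2.
Proof.
by rewrite /dihedral_coef divr1 cosPI mulrN1.
Qed.

Lemma angle_bounds m : (1 < m)%N -> 0 < PI / m%:R < PI.
Proof.
move=> m1; have m0 : 0 < m%:R :> R by rewrite ltr0n; lia.
by rewrite divr_gt0 ?PI_gt0 //= ltr_pdivrMr // ltr_pMr ?PI_gt0 // ltr1n.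
Qed.

Lemma sin_angle m : (1 < m)%N -> 0 < sin (PI / m%:R).
Proof. by move=> /angle_bounds/andP[? ?]; apply: sin_gt0. Qed.

(** For 1 < m the value is sin (n pi / m) / sin (pi / m); for m = 0 it is n. *)
Lemma cheb_ge0 m n : m != 1%N -> (n <= m)%N || (m == 0%N) ->
  0 <= cheb (dihedral_coef m) n.
Proof.
have [-> _ _|m0 m1 /orP[nm|//]] := eqVneq m 0%N.
  suff -> : cheb (dihedral_coef 0) n = n%:R by rewrite ler0n.
  rewrite dihedral_coef0.
  suff: cheb 2 n = n%:R /\ cheb 2 n.+1 = n.+1%:R by case.
  elim: n => [//|n [IH1 IH2]]; split=> //.
  by rewrite chebSS IH1 IH2 -!natr1; ring.
have m2 : (1 < m)%N by lia.
rewrite -(pmulr_rge0 _ (sin_angle m2)) cheb_sin.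
have /andP[t0 _] := angle_bounds m2.
apply: sin_ge0; first by rewrite mulr_ge0 ?ler0n // ltW.
rewrite mulrCA ger_pMr ?PI_gt0 // ler_pdivrMr ?ltr0n; last by lia.
by rewrite mul1r ler_nat.
Qed.

Lemma cheb_period m : (1 < m)%N ->
  cheb (dihedral_coef m) m.*2 = 0 /\ cheb (dihedral_coef m) m.*2.+1 = 1.
Proof.
move=> m1; have s0 := sin_angle m1.
have m0 : m%:R != 0 :> R by rewrite pnatr_eq0; lia.
have twopi : m.*2%:R * (PI / m%:R) = 2 * PI :> R.
  by rewrite -muln2 natrM; field.
split; apply: (mulfI (lt0r_neq0 s0)); rewrite cheb_sin.
  rewrite twopi mulr0 mulrDl mul1r sinD.
  by rewrite sinPI mul0r mulr0 addr0.
rewrite -natr1 mulrDl mul1r twopi mulr1 addrC mulrDl mul1r !sinD !cosD.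
rewrite sinPI cosPI.
by ring.
Qed.

(** The form on the plane of two generators with finite m(s, t) is
nondegenerate: 4 - k ^ 2 is 4 sin (pi / m) ^ 2. *)
Lemma dihedral_coef_sqr m : (1 < m)%N -> dihedral_coef m ^+ 2 != 4.
Proof.
move=> m1; have := sin_angle m1; rewrite /dihedral_coef.
set x := PI / _ => s0; apply/eqP => e.
have := Rtrigo1.sin2_cos2 x; rewrite /RIneq.Rsqr !RealsE => e1.
have : sin x * sin x = 0 by nra.
by nra.
Qed.

Lemma dihedral_coef_ge0 m : m != 1%N -> 0 <= dihedral_coef m.
Proof.
move=> m1; have := @cheb_ge0 m 2 m1; rewrite chebSS cheb0 cheb1 mulr1 subr0.
by apply; lia.
Qed.

(** If k is the coefficient, the third Chebyshev value k ^ 2 - 1 is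
nonnegative. *)
Lemma dihedral_coef_ge1 m : (m == 0%N) || (2 < m)%N -> 1 <= dihedral_coef m.
Proof.
move=> m1; have := @cheb_ge0 m 3; rewrite !chebSS cheb0 cheb1 mulr1 subr0.
have -> : m != 1%N by lia.
have k0 : 0 <= dihedral_coef m by apply: dihedral_coef_ge0; lia.
by move=> /(_ isT); rewrite orbC m1 => /(_ isT); nra.
Qed.

(** * The group of invertible matrices *)

Section InvertibleMatrices.
Variable n : nat.

(** A group type is needed as the target of the universal property of W. *)
Definition gl := {A : 'M[R]_n | A \in unitmx}.
HB.instance Definition _ := Choice.on gl.

Let gl_one : gl := Sub 1%:M (unitmx1 _ _).
Let gl_mul (A B : gl) : gl :=
  insubd gl_one (val A *m val B).
Let gl_inv (A : gl) : gl := insubd gl_one (invmx (val A)).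

Let unit_val (A : gl) : val A \in unitmx. Proof. exact: valP. Qed.

Let val_mul A B : val (gl_mul A B) = val A *m val B.
Proof. by rewrite /gl_mul val_insubd unitmx_mul !unit_val. Qed.
Let val_inv A : val (gl_inv A) = invmx (val A).
Proof. by rewrite /gl_inv val_insubd unitmx_inv unit_val. Qed.

Let gl_mulA : associative gl_mul.
Proof. by move=> A B D; apply: val_inj; rewrite !val_mul mulmxA. Qed.
Let gl_mul1 : left_id gl_one gl_mul.
Proof. by move=> A; apply: val_inj; rewrite val_mul mul1mx. Qed.
Let gl_1mul : right_id gl_one gl_mul.
Proof. by move=> A; apply: val_inj; rewrite val_mul mulmx1. Qed.
Let gl_mulV : left_inverse gl_one gl_inv gl_mul.
Proof.
by move=> A; apply: val_inj; rewrite val_mul val_inv mulVmx ?unit_val.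
Qed.
Let gl_Vmul : right_inverse gl_one gl_inv gl_mul.
Proof.
by move=> A; apply: val_inj; rewrite val_mul val_inv mulmxV ?unit_val.
Qed.

HB.instance Definition _ :=
  isGroup.Build gl gl_mulA gl_mul1 gl_1mul gl_mulV gl_Vmul.

Lemma gl_valM (A B : gl) : val (A * B)%g = val A *m val B.
Proof. exact: val_mul. Qed.

Lemma gl_val1 : val (1%g : gl) = 1%:M.
Proof. by []. Qed.

End InvertibleMatrices.

(** * The geometric representation *)

Section Geometric.
Variables (W : groupType) (S : finType) (C : coxeterSystem W S).

Local Notation V := 'rV[R]_#|S|.

Definition coord (v : V) (s : S) : R := v 0 (enum_rank s).
Definition root (s : S) : V := delta_mx 0 (enum_rank s).
Definition edge_coef (s t : S) : R := dihedral_coef (coxmat C s t).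
(** Twice the bilinear form of v with the root of s. *)
Definition pairing (s : S) (v : V) : R := - \sum_t coord v t * edge_coef t s.
(** Row vectors are acted on from the right, so that the image of v under w in
the sense of [act] below is w^-1 v in the usual left representation. *)
Definition refl (s : S) : 'M[R]_#|S| :=
  1%:M - (\col_j - edge_coef (enum_val j) s) *m root s.

Lemma coordP u v : (forall s, coord u s = coord v s) -> u = v.
Proof.
move=> e; apply/rowP => j; have := e (enum_val j).
by rewrite /coord enum_valK.
Qed.

Lemma coordD u v s : coord (u + v) s = coord u s + coord v s.
Proof. by rewrite /coord mxE. Qed.

Lemma coordB u v s : coord (u - v) s = coord u s - coord v s.
Proof. by rewrite /coord !mxE. Qed.

Lemma coordN u s : coord (- u) s = - coord u s.
Proof. by rewrite /coord !mxE. Qed.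

Lemma coordZ a v s : coord (a *: v) s = a * coord v s.
Proof. by rewrite /coord mxE. Qed.

Lemma coord_root s t : coord (root s) t = (t == s)%:R.
Proof. by rewrite /coord mxE eqxx (inj_eq enum_rank_inj). Qed.

Lemma edge_coefC s t : edge_coef s t = edge_coef t s.
Proof. by rewrite /edge_coef coxmat_sym. Qed.

Lemma edge_coef_id s : edge_coef s s = - 2.
Proof.
rewrite /edge_coef; have /eqP -> : coxmat C s s == 1%N by rewrite coxmat_eq1.
exact: dihedral_coef1.
Qed.

Lemma edge_coef_ge0 s t : s != t -> 0 <= edge_coef s t.
Proof. by move=> st; apply: dihedral_coef_ge0; rewrite coxmat_eq1. Qed.

Lemma pairingD s u v : pairing s (u + v) = pairing s u + pairing s v.
Proof.
rewrite /pairing -opprD -big_split; congr (- _); apply: eq_bigr => t _.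
by rewrite coordD mulrDl.
Qed.

Lemma pairingZ s a v : pairing s (a *: v) = a * pairing s v.
Proof.
rewrite /pairing mulrN mulr_sumr; congr (- _); apply: eq_bigr => t _.
by rewrite coordZ -mulrA.
Qed.

Lemma pairing_root s t : pairing s (root t) = - edge_coef s t.
Proof.
rewrite /pairing (bigD1 t) //= big1 => [|u ut].
  by rewrite coord_root eqxx mul1r addr0 edge_coefC.
by rewrite coord_root (negPf ut) mul0r.
Qed.

Lemma mul_refl v s : v *m refl s = v - pairing s v *: root s.
Proof.
rewrite /refl mulmxBr mulmx1 mulmxA; congr (_ - _).
rewrite [v *m _]mx11_scalar mul_scalar_mx; congr (_ *: _).
rewrite mxE /pairing -sumrN (reindex _ (onW_bij _ (@enum_rank_bij S))) /=.
  by apply: eq_bigr => t _; rewrite mxE enum_rankK mulrN.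
Qed.

Lemma root_refl s : root s *m refl s = - root s.
Proof.
rewrite mul_refl pairing_root edge_coef_id opprK.
by apply: coordP => t; rewrite coordB coordN coordZ; ring.
Qed.

Lemma root_refl_neq s t : root s *m refl t = root s + edge_coef s t *: root t.
Proof. by rewrite mul_refl pairing_root edge_coefC scaleNr opprK. Qed.

Lemma reflK s : refl s *m refl s = 1%:M.
Proof.
apply/row_matrixP => i; rewrite row_mul -[i]enum_valK; set t := enum_val i.
have -> : row (enum_rank t) (refl s) = root t *m refl s by rewrite rowE.
rewrite root_refl_neq mulmxDl -scalemxAl root_refl root_refl_neq row1.
by rewrite scalerN addrK.
Qed.

Lemma refl_unit s : refl s \in unitmx.
Proof. by have [] := mulmx1_unit (reflK s). Qed.

Definition grefl s : gl #|S| := Sub (refl s) (refl_unit s).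

(** For m(s, t) finite and up to the factor sin (pi / m), these are the vectors
at angles that are multiples of pi / m in the plane of the roots of s and
t; the two reflections shift n, so that their product is a rotation. *)
Definition dihedral_vec s t n : V :=
  cheb (edge_coef s t) n *: root s + cheb (edge_coef s t) n.+1 *: root t.

Lemma dihedral_vec_refl s t n :
  dihedral_vec s t n *m refl s = dihedral_vec t s n.+1.
Proof.
rewrite mulmxDl -!scalemxAl root_refl root_refl_neq /dihedral_vec.
rewrite (edge_coefC t s) chebSS.
by apply: coordP => x; rewrite !(coordD, coordZ, coordN); ring.
Qed.

Lemma dihedral_vec_rotate s t n j :
  dihedral_vec s t n *m val ((grefl s * grefl t) ^+ j)%g =
  dihedral_vec s t (n + j.*2).
Proof.
elim: j n => [|j IHj] n; first by rewrite mulmx1 addn0.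
rewrite expgS !gl_valM !mulmxA /= dihedral_vec_refl dihedral_vec_refl IHj.
by congr dihedral_vec; lia.
Qed.

(** The plane of the two roots is rotated by 2 pi / m at each step, hence is
fixed by the m-th power. As the form is nondegenerate on that plane, every
vector is the sum of a vector of the plane and of a vector fixed by both
reflections. *)
Lemma refl_rel s t : ((grefl s * grefl t) ^+ coxmat C s t = 1)%g.
Proof.
apply: val_inj; rewrite gl_val1.
have [m0|m0] := eqVneq (coxmat C s t) 0%N; first by rewrite m0.
have [st|st] := eqVneq s t.
  rewrite st; have /eqP -> : coxmat C t t == 1%N by rewrite coxmat_eq1.
  by rewrite expg1 gl_valM reflK.
have m1 : (1 < coxmat C s t)%N.
  by have := coxmat_eq1 C s t; rewrite (negPf st); lia.
have [p0 p1] := cheb_period m1.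
set g := ((_ * _) ^+ _)%g; set k := edge_coef s t.
have fix_t : root t *m val g = root t.
  have := dihedral_vec_rotate s t 0 (coxmat C s t); rewrite add0n /dihedral_vec.
  by rewrite p0 p1 cheb0 cheb1 !scale0r !scale1r !add0r.
have fix_s : root s *m val g = root s.
  have := dihedral_vec_rotate s t 1 (coxmat C s t); rewrite add1n /dihedral_vec.
  rewrite !chebSS p0 p1 cheb0 cheb1 !mulr1 !subr0 !scale1r.
  by rewrite mulmxDl -scalemxAl fix_t => /addIr.
suff fix_all (v : V) : v *m val g = v.
  by apply/row_matrixP => i; rewrite !rowE fix_all mulmx1.
have k4 : 4 - k ^+ 2 != 0.
  by rewrite subr_eq0 eq_sym; apply: dihedral_coef_sqr.
(* solve for the component of v in the plane of the two roots *)
pose a := (2 * pairing s v + k * pairing t v) / (4 - k ^+ 2).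
pose b := (2 * pairing t v + k * pairing s v) / (4 - k ^+ 2).
pose u := v - (a *: root s + b *: root t).
have -> : v = u + (a *: root s + b *: root t) by rewrite subrK.
have pu x : pairing x u = pairing x v + a * edge_coef x s + b * edge_coef x t.
  rewrite /u -scaleN1r pairingD pairingZ pairingD !pairingZ !pairing_root.
  by ring.
have pus : pairing s u = 0.
  by rewrite pu edge_coef_id -/k /a /b; field.
have put : pairing t u = 0.
  by rewrite pu edge_coef_id (edge_coefC t s) -/k /a /b; field.
have fix_u j : u *m val ((grefl s * grefl t) ^+ j)%g = u.
  elim: j => [|j IHj]; first by rewrite mulmx1.
  rewrite expgS !gl_valM !mulmxA /= !mul_refl pus scale0r subr0.
  by rewrite put scale0r subr0.
by rewrite mulmxDl fix_u mulmxDl -!scalemxAl fix_s fix_t.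
Qed.

Lemma geom_rep_ex : exists M : W -> 'M[R]_#|S|,
  [/\ M 1%g = 1%:M, forall u w, M (u * w)%g = M u *m M w
    & forall s, M (gen C s) = refl s].
Proof.
have [phi phiE] := gen_univ refl_rel.
exists (fun w => val (phi w)); split=> [|u w|s]; last by rewrite phiE.
  have e : (phi 1 = phi 1 * phi 1)%g by rewrite -gmulfM mulg1.
  by rewrite -gl_val1 -(mulVg (phi 1%g)) {3}e mulgA mulVg mul1g.
by rewrite gmulfM gl_valM.
Qed.

Definition geom_rep : W -> 'M[R]_#|S| := sval (cid geom_rep_ex).

Definition act (v : V) (w : W) : V := v *m geom_rep w.

Lemma act_gen v s : act v (gen C s) = v - pairing s v *: root s.
Proof.
by rewrite /act /geom_rep; case: cid => M /= [_ _ ->]; rewrite mul_refl.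
Qed.

Lemma actM v u w : act v (u * w)%g = act (act v u) w.
Proof.
by rewrite /act /geom_rep; case: cid => M /= [_ -> _]; rewrite mulmxA.
Qed.

Lemma gen_sqr s : (gen C s * gen C s)%g = 1%g.
Proof.
have := gen_rel C s s; have /eqP -> : coxmat C s s == 1%N by rewrite coxmat_eq1.
by rewrite expg1.
Qed.

Lemma genK s w : (gen C s * (gen C s * w))%g = w.
Proof. by rewrite mulgA gen_sqr mul1g. Qed.

Lemma act_root s : act (root s) (gen C s) = - root s.
Proof. by rewrite act_gen -mul_refl root_refl. Qed.

Lemma actD u v w : act (u + v) w = act u w + act v w.
Proof. exact: mulmxDl. Qed.

Lemma actZ a v w : act (a *: v) w = a *: act v w.
Proof. by rewrite /act -scalemxAl. Qed.

Lemma actN v w : act (- v) w = - act v w.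
Proof. exact: mulNmx. Qed.

Lemma act1 v : act v 1%g = v.
Proof.
by rewrite /act /geom_rep; case: cid => M /= [-> _ _]; rewrite mulmx1.
Qed.

(** * Length, and the sign of the image of a simple root *)

Local Notation len := (cox_length C).

Definition word (u : seq S) : W := (\prod_(s <- u) gen C s)%g.

Lemma word0 : word [::] = 1%g.
Proof. exact: big_nil. Qed.

Lemma word_cons s u : word (s :: u) = (gen C s * word u)%g.
Proof. exact: big_cons. Qed.

Lemma word_cat u v : word (u ++ v) = (word u * word v)%g.
Proof. exact: big_cat. Qed.

Lemma word1 s : word [:: s] = gen C s.
Proof. exact: big_seq1. Qed.

Lemma len_word u : (len (word u) <= size u)%N.
Proof.
rewrite /cox_length; case: ex_minnP => n _; apply.
by apply/existsP; exists (in_tuple u).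
Qed.

Lemma reduced_word w : exists2 u, w = word u & size u = len w.
Proof.
rewrite /cox_length; case: ex_minnP => n /existsP[u /eqP ->] _.
by exists u; rewrite ?size_tuple.
Qed.

Lemma len1 : len 1%g = 0%N.
Proof. by apply/eqP; rewrite -leqn0; have := len_word [::]; rewrite word0. Qed.

Lemma lenM u w : (len (u * w)%g <= len u + len w)%N.
Proof.
have [x -> <-] := reduced_word u; have [y -> <-] := reduced_word w.
by rewrite -word_cat -size_cat; apply: len_word.
Qed.

Lemma len_gen s : (len (gen C s) <= 1)%N.
Proof. by have := len_word [:: s]; rewrite word1. Qed.

Lemma len_genM s w : (len (gen C s * w)%g <= (len w).+1)%N.
Proof. by have := lenM (gen C s) w; have := len_gen s; lia. Qed.

Lemma len_le_genM s w : (len w <= (len (gen C s * w)%g).+1)%N.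
Proof. by rewrite -{1}(genK s w) len_genM. Qed.

Definition nonneg (v : 'rV[R]_#|S|) : Prop := forall s, 0 <= coord v s.

Lemma nonnegD u v : nonneg u -> nonneg v -> nonneg (u + v).
Proof. by move=> pu pv s; rewrite coordD addr_ge0. Qed.

Lemma nonnegZ a v : 0 <= a -> nonneg v -> nonneg (a *: v).
Proof. by move=> a0 pv s; rewrite coordZ mulr_ge0. Qed.

Lemma nonneg_root s : nonneg (root s).
Proof. by move=> t; rewrite coord_root ler0n. Qed.

Fixpoint alternating (s t : S) (n : nat) : seq S :=
  if n is n'.+1 then s :: alternating t s n' else [::].

Lemma size_alt s t n : size (alternating s t n) = n.
Proof. by elim: n s t => //= n IHn s t; rewrite IHn. Qed.

Lemma alt_prefix s t m n : (m <= n)%N ->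
  exists2 z, alternating s t n = alternating s t m ++ z & size z = (n - m)%N.
Proof.
elim: m n s t => [|m IHm] n s t mn.
  by exists (alternating s t n); rewrite ?size_alt ?subn0.
by case: n mn => // n /(IHm n t s)[z zE zs]; exists z; rewrite //= zE.
Qed.

Lemma word_altE s t n :
  word (alternating s t n) =
  ((gen C s * gen C t) ^+ n * word (alternating t s n))%g.
Proof.
elim: n s t => [|n IHn] s t; first by rewrite !word0 mulg1.
rewrite /= !word_cons IHn !mulgA; congr (_ * _)%g.
rewrite expgSr -!mulgA gen_sqr mulg1.
elim: n {IHn} => [|n IHn]; rewrite ?expg0 ?mul1g ?mulg1 //.
by rewrite !expgS -!mulgA IHn.
Qed.

Lemma braid s t :
  word (alternating s t (coxmat C s t)) = word (alternating t s (coxmat C s t)).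
Proof. by rewrite word_altE gen_rel mul1g. Qed.

Lemma alt_or_shorter s t x : all (mem [:: s; t]) x ->
  [\/ x = alternating s t (size x), x = alternating t s (size x)
    | exists2 y, word y = word x & (size y < size x)%N].
Proof.
elim: x => [|r x IHx] /=; first by constructor 1.
case/andP=> rst /IHx{IHx} IHx.
have cancel a b n : x = alternating a b n.+1 -> r = a ->
    exists2 y, word y = word (r :: x) & (size y < (size x).+1)%N.
  move=> -> ->; exists (alternating b a n); last by rewrite !size_alt; lia.
  by rewrite /= !word_cons genK.
case: IHx => [xE|xE|[y yE ys]]; last first.
- by constructor 3; exists (r :: y); rewrite ?word_cons ?yE.
- case: (size x) xE cancel => [|n] xE cancel.
    by move: rst; rewrite xE !inE => /orP[]/eqP ->;
      [constructor 1|constructor 2].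
  move: rst; rewrite !inE => /orP[]/eqP rE.
    by constructor 1; rewrite rE xE.
  by constructor 3; apply: cancel xE rE.
case: (size x) xE cancel => [|n] xE cancel.
  by move: rst; rewrite xE !inE => /orP[]/eqP ->;
      [constructor 1|constructor 2].
move: rst; rewrite !inE => /orP[]/eqP rE; last first.
  by constructor 2; rewrite rE xE.
by constructor 3; apply: cancel xE rE.
Qed.

Lemma act_alt s t n j :
  let v := act (dihedral_vec s t j) (word (alternating s t n)) in
  v = dihedral_vec s t (j + n) \/ v = dihedral_vec t s (j + n).
Proof.
elim: n s t j => [|n IHn] s t j /=; first by left; rewrite word0 act1 addn0.
have e : act (dihedral_vec s t j) (gen C s) = dihedral_vec t s j.+1.
  by rewrite act_gen -mul_refl dihedral_vec_refl.
rewrite /= word_cons actM e addnS -addSn.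
by case: (IHn t s j.+1) => ->; [right|left].
Qed.

(** Induction on the length of w. If t is a first letter of a reduced word of
w, split w as x v with x a word in s and t, lengths adding up, and x as
long as possible. The roots of s and t stay nonnegative under v by
induction, and x is an alternating word starting with t that is too short
to reach the longest element of the dihedral group, so that it maps the
root of s to a nonnegative combination of the two roots. *)
Lemma pos_root w s : (len w <= len (gen C s * w)%g)%N ->
  nonneg (act (root s) w).
Proof.
have [n] := ubnP (len w); elim: n w s => // n IHn w s lew lesw.
have [u wE su] := reduced_word w.
case: u wE su => [|t u] wE su.
  by rewrite wE word0 act1; apply: nonneg_root.
rewrite word_cons in wE; have := len_word u; rewrite /= in su => lu.
have ts : t != s.
  by apply/eqP => ts; move: lesw; rewrite wE ts genK -ts -wE -su; lia.
pose P k := `[< exists (x : seq S) v,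
  [/\ all (mem [:: s; t]) x, w = (word x * v)%g, size x = k
    & (k + len v = len w)%N] >].
have P1 : P 1%N.
  apply/asboolP; exists [:: t], (word u); rewrite /= !inE eqxx orbT word1.
  by split=> //; have := len_genM t (word u); rewrite -wE -su; lia.
have Pmax k : P k -> (k <= len w)%N.
  by move=> /asboolP[x [v [_ _ _ <-]]]; rewrite leq_addr.
case: (ex_maxnP (ex_intro P 1%N P1) Pmax) => k /asboolP[x [v]].
case=> xst wxv sx kv kmax.
have k1 := kmax _ P1.
(* otherwise r could be moved from v to x *)
have posv r : r \in [:: s; t] -> nonneg (act (root r) v).
  move=> rst; apply: IHn; first by lia.
  rewrite leqNgt; apply/negP => lrv.
  suff /kmax : P k.+1 by rewrite ltnn.
  apply/asboolP; exists (rcons x r), (gen C r * v)%g.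
  have wE' : w = (word (rcons x r) * (gen C r * v))%g.
    by rewrite -cats1 word_cat word1 -mulgA genK.
  split=> //; rewrite ?all_rcons ?xst ?size_rcons ?sx //.
    by rewrite /= rst.
  have := len_word (rcons x r); have := lenM (word (rcons x r)) (gen C r * v)%g.
  by rewrite -wE' size_rcons sx; lia.
(* x is a shortest expression, and no expression of s x is shorter *)
have red (y : seq S) : word y = word x -> (k <= size y)%N.
  move=> yE; have := lenM (word y) v; rewrite yE -wxv -yE.
  by have := len_word y; lia.
have reds (y : seq S) : word y = (gen C s * word x)%g -> (k <= size y)%N.
  move=> yE; move: lesw.
  have -> : (gen C s * w = word y * v)%g by rewrite yE wxv mulgA.
  by have := lenM (word y) v; have := len_word y; lia.
have xE : x = alternating t s k.
  case: (alt_or_shorter xst) => [e|e|[y /red ky]]; last by rewrite sx ltnNge ky.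
  - have := @reds (behead x); rewrite size_behead sx => /(_ _).
    rewrite e sx; case: (k) k1 => //= k' _.
    by rewrite word_cons genK ltnn => /(_ erefl).
  - by rewrite {1}e sx.
have km : (k.+1 <= coxmat C t s)%N || (coxmat C t s == 0%N).
  (* otherwise the braid relation lets x start with s, against reds *)
  rewrite orbC; case: eqVneq => //= m0; rewrite ltnNge; apply/negP => mk.
  have [z zE zs] := alt_prefix t s mk.
  have := @reds (behead (alternating s t (coxmat C t s)) ++ z).
  rewrite size_cat size_behead size_alt zs xE zE !word_cat /= braid.
  case: (coxmat C t s) m0 mk => // m _ mk /=.
  by rewrite !word_cons !mulgA gen_sqr mul1g => /(_ erefl); lia.
have m1 : coxmat C t s != 1%N by rewrite coxmat_eq1.
have rE : root s = dihedral_vec t s 0.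
  by rewrite /dihedral_vec cheb0 cheb1 scale0r add0r scale1r.
rewrite wxv actM xE rE.
have c0 : 0 <= cheb (edge_coef t s) k by apply: cheb_ge0 => //; lia.
have c1 : 0 <= cheb (edge_coef t s) k.+1 by apply: cheb_ge0.
case: (act_alt t s k 0) => ->; rewrite add0n /dihedral_vec actD !actZ;
  rewrite 1?(edge_coefC s t); apply: nonnegD; apply: nonnegZ => //;
  by apply: posv; rewrite !inE eqxx ?orbT.
Qed.

Lemma act_inj w : injective (fun v => act v w).
Proof.
move=> u v /(congr1 (fun z => act z (w^-1)%g)).
by rewrite -!actM mulgV !act1.
Qed.

Definition descent w s : bool := (len (gen C s * w)%g < len w)%N.

(** If s were an ascent, the image of its root would be nonnegative as well,
hence zero. *)
Lemma descentP w s : reflect (nonneg (- act (root s) w)) (descent w s).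
Proof.
rewrite /descent; apply: (iffP idP) => [lt|neg].
  rewrite -actN -act_root -actM; apply: pos_root.
  by rewrite genK ltnW.
rewrite ltnNge; apply/negP => /pos_root pos.
have z : act (root s) w = 0.
  apply: coordP => t; have := pos t; have := neg t; rewrite coordN.
  by rewrite {4}/coord mxE; lra.
have z0 : act 0 w = 0 by rewrite /act mul0mx.
have /(congr1 (fun v => coord v s)) : root s = 0.
  by apply: (@act_inj w); rewrite z.
by rewrite coord_root eqxx /coord mxE => /eqP; rewrite oner_eq0.
Qed.

Lemma len_descent w s : descent w s -> len w = (len (gen C s * w)%g).+1.
Proof. by rewrite /descent => lt; have := len_le_genM s w; lia. Qed.

Lemma len_ascent w s : ~~ descent w s -> len (gen C s * w)%g = (len w).+1.
Proof.
move=> nd; suff : descent (gen C s * w)%g s by move/len_descent; rewrite genK.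
apply/descentP; rewrite actM act_root actN opprK.
by apply: pos_root; rewrite leqNgt.
Qed.

(** * Stripping a word from the left, and its cone *)

(** Two generators that do not commute have m(s, t) = 0 or m(s, t) > 2. *)
Lemma edge_coef_ge1 s t : diagram C s t -> 1 <= edge_coef s t.
Proof.
case/andP=> st nc; apply: dihedral_coef_ge1.
have := coxmat_eq1 C s t; rewrite (negPf st).
case m2 : (coxmat C s t) => [|[|[|m]]] // _.
case/negP: nc; apply/eqP; have := gen_rel C s t; rewrite m2 expg2 => e.
have /(congr1 (fun x => gen C s * x * gen C t)%g) := e.
by rewrite mulg1 -!mulgA genK gen_sqr mulg1 => ->.
Qed.

(** For a root v this says that v is an inversion of w. Unlike the set of
inversions, these vectors form a convex cone. *)
Definition inverted (w : W) (v : V) : Prop := nonneg (- act v w).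

Lemma invertedD w u v : inverted w u -> inverted w v -> inverted w (u + v).
Proof. by move=> bu bv; rewrite /inverted actD opprD; apply: nonnegD. Qed.

Lemma invertedZ w a v : 0 <= a -> inverted w v -> inverted w (a *: v).
Proof. by move=> a0 bv; rewrite /inverted actZ -scalerN; apply: nonnegZ. Qed.

Lemma inverted_act w s v :
  inverted w (act v (gen C s)) <-> inverted (gen C s * w)%g v.
Proof. by rewrite /inverted actM. Qed.

Lemma coord_act_word u s v : s \notin u -> coord (act v (word u)) s = coord v s.
Proof.
elim: u v => [|t u IHu] v; first by rewrite word0 act1.
rewrite inE negb_or => /andP[st su]; rewrite word_cons actM IHu // act_gen.
by rewrite coordB coordZ coord_root (negPf st) mulr0 subr0.
Qed.

(** The other generators do not change the coordinate along s, so the root of s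
cannot become negative. *)
Lemma len_word_uniq u : uniq u -> len (word u) = size u.
Proof.
elim: u => [|s u IHu] /=; first by rewrite word0 len1.
case/andP=> su uu; rewrite word_cons len_ascent ?IHu //.
apply/negP => /descentP/(_ s); rewrite coordN coord_act_word // coord_root eqxx.
by rewrite oppr_ge0 ler10.
Qed.

Fixpoint strip (u : seq S) (w : W) : bool :=
  if u is s :: u' then descent w s && strip u' (gen C s * w)%g else true.

Lemma strip_cat u1 u2 w :
  strip (u1 ++ u2) w = strip u1 w && strip u2 ((word u1)^-1 * w)%g.
Proof.
elim: u1 w => [|s u1 IHu] w /=; first by rewrite word0 invg1 mul1g.
rewrite IHu word_cons invgM -!mulgA andbA; congr (_ && strip _ _).
by congr (_ * _)%g; rewrite -{2}(genK s w) mulKg.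
Qed.

(** Both sides say that each letter lowers the length; this uses that the word
is reduced. *)
Lemma weak_le_word u w : uniq u -> weak_le C (word u) w = strip u w.
Proof.
elim: u w => [|s u IHu] w.
  by rewrite /weak_le word0 invg1 mul1g len1 add0n eqxx.
move=> uu; have /= /andP[su u'] := uu; rewrite -IHu // /weak_le.
rewrite !len_word_uniq // word_cons invgM -!mulgA.
have -> : ((gen C s)^-1 * w = gen C s * w)%g by rewrite -{1}(genK s w) mulKg.
set x := (_ * _)%g; have lx : (len (gen C s * w)%g <= size u + len x)%N.
  have := lenM (word u) x; rewrite len_word_uniq //.
  by rewrite /x mulVKg.
have [d|/len_ascent e] := boolP (descent w s); last first.
  by rewrite addSn; apply/eqP => E; move: lx; rewrite e -E ltnNge leqnSn.
by rewrite (len_descent d) addSn eqSS.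
Qed.

(** Minus the pairing with s of the part of v that is supported on u, when the
letters of u are distinct. *)
Definition inflow (u : seq S) (s : S) (v : V) : R :=
  \sum_(t <- u) coord v t * edge_coef t s.

Lemma inflow_cat u1 u2 s v :
  inflow (u1 ++ u2) s v = inflow u1 s v + inflow u2 s v.
Proof. exact: big_cat. Qed.

Lemma inflow_cons t u s v :
  inflow (t :: u) s v = coord v t * edge_coef t s + inflow u s v.
Proof. exact: big_cons. Qed.

Lemma inflow_ge0 u s v : s \notin u -> nonneg v -> 0 <= inflow u s v.
Proof.
move=> su pv; rewrite /inflow big_seq; apply: sumr_ge0 => t tu.
by rewrite mulr_ge0 // edge_coef_ge0 //; apply: contraNneq su => <-.
Qed.

Lemma inflow_addroot u s t a v :
  t \notin u -> inflow u s (v + a *: root t) = inflow u s v.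
Proof.
move=> tu; rewrite /inflow [LHS]big_seq [RHS]big_seq; apply: eq_bigr => r ru.
rewrite coordD coordZ coord_root; have /negPf -> : r != t.
  by apply: contraNneq tu => <-.
by rewrite mulr0 addr0.
Qed.

Lemma inflow_ge u s t v : t \in u -> s \notin u -> nonneg v ->
  coord v t * edge_coef t s <= inflow u s v.
Proof.
case/splitPr=> u1 u2; rewrite mem_cat inE !negb_or => /and3P[s1 st s2] pv.
rewrite inflow_cat inflow_cons.
by have := inflow_ge0 s1 pv; have := inflow_ge0 s2 pv; lra.
Qed.

Definition supported (u : seq S) (v : V) : Prop :=
  forall t, t \notin u -> coord v t = 0.

Lemma pairing_supported u s v : uniq u -> supported u v ->
  pairing s v = - inflow u s v.
Proof.
move=> uu sv; rewrite /pairing /inflow; congr (- _).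
rewrite [RHS]big_uniq //= [RHS]big_mkcond /=; apply: eq_bigr => t _.
by case: ifPn => // /sv ->; rewrite mul0r.
Qed.

(** The convex cone generated by the inversions of the product of u, when the
letters of u are distinct: the coordinate of such a vector along a letter s
is at least the inflow from the letters that come after s. *)
Definition cone (u : seq S) (v : V) : Prop :=
  [/\ nonneg v, supported u v
    & forall u1 s u2, u = u1 ++ s :: u2 -> inflow u2 s v <= coord v s].

(** Let s be the first letter, a the coordinate of v along s and v' = v - a s.
Then v is (a - inflow) s plus the image of v' under s, and v' is in the
cone of the remaining word, for which s w is used. *)
Lemma strip_cone u w v : uniq u -> strip u w -> cone u v -> inverted w v.
Proof.
elim: u w v => [|s u IHu] w v /=.
  move=> _ _ [_ sv _]; have -> : v = 0.
    by apply: coordP => t; rewrite sv // /coord mxE.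
  by move=> t; rewrite /act mul0mx /coord !mxE oppr0.
case/andP=> su uu /andP[/descentP ds stu] [pv sv cv].
set a := coord v s; pose v' := v + (- a) *: root s.
have v's t : coord v' t = if t == s then 0 else coord v t.
  rewrite coordD coordZ coord_root; case: eqVneq => [->|_].
    by rewrite mulr1 subrr.
  by rewrite mulr0 addr0.
have cv' : cone u v'.
  split=> [t|t tu|u1 r u2 uE].
  - by rewrite v's; case: ifP.
  - by rewrite v's; case: eqVneq => // ts; rewrite sv // inE negb_or ts.
  move: su uu; rewrite uE mem_cat inE !negb_or => /and3P[s1 sr s2] _.
  rewrite inflow_addroot // v's eq_sym (negPf sr).
  by apply: (cv (s :: u1)); rewrite uE.
have -> : v = (a - inflow u s v) *: root s + act v' (gen C s).
  rewrite act_gen (pairing_supported s uu) //; last by case: cv'.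
  rewrite inflow_addroot //; apply: coordP => t.
  by rewrite !(coordD, coordB, coordN, coordZ); ring.
apply: invertedD; last by apply/inverted_act; apply: IHu.
by apply: invertedZ => //; rewrite subr_ge0; apply: (cv [::]).
Qed.

(** The root of the first letter s lies in the cone, and so does the image
under s of the cone of the remaining word. *)
Lemma cone_strip u w :
  uniq u -> (forall v, cone u v -> inverted w v) -> strip u w.
Proof.
elim: u w => // s u IHu w /= /andP[su uu] cw; apply/andP; split.
  apply/descentP; apply: cw; split=> [t|t|u1 r u2 uE].
  - exact: nonneg_root.
  - by rewrite inE negb_or coord_root => /andP[/negPf ->].
  have s2 : s \notin u2.
    case: u1 uE => [|x u1] /= [sx uE]; first by rewrite -uE.
    by move: su; rewrite uE mem_cat inE !negb_or => /and3P[].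
  rewrite /inflow big_seq big1 => [|t t2]; first exact: nonneg_root.
  rewrite coord_root; have /negPf -> : t != s by apply: contraNneq s2 => <-.
  by rewrite mul0r.
apply: IHu => // v [pv sv cv]; apply/inverted_act; apply: cw.
have aE : act v (gen C s) = v + inflow u s v *: root s.
  by rewrite act_gen (pairing_supported s uu) // scaleNr opprK.
rewrite aE; split=> [t|t|u1 r u2 uE].
- by rewrite coordD coordZ addr_ge0 // mulr_ge0 ?inflow_ge0 ?nonneg_root.
- rewrite inE negb_or => /andP[ts tu].
  by rewrite coordD coordZ coord_root (negPf ts) sv // mulr0 addr0.
case: u1 uE => [|x u1] /= [sx uE].
  rewrite -uE -sx inflow_addroot // coordD coordZ coord_root eqxx (sv s su).
  by rewrite mulr1 add0r.
have := su; rewrite uE mem_cat inE !negb_or => /and3P[s1 sr s2].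
rewrite inflow_addroot // coordD coordZ coord_root.
rewrite eq_sym (negPf sr) mulr0 addr0.
exact: cv uE.
Qed.

(** The reflection in s adds to a vector of the cone of u a nonnegative
multiple of the root of s, which is itself inverted. *)
Lemma strip_gen_notin u w s :
  uniq u -> descent w s -> strip u w -> s \notin u -> strip u (gen C s * w)%g.
Proof.
move=> uu /descentP ds stu su; apply: cone_strip => // v cv; apply/inverted_act.
have [pv sv _] := cv; rewrite act_gen (pairing_supported s uu) // scaleNr opprK.
apply: invertedD; first exact: strip_cone cv.
by apply: invertedZ => //; apply: inflow_ge0.
Qed.

(** Let f1, f2 be the inflows at s from the letters before and after s, and a
the coordinate at s of a vector v of the cone. The reflection changes a
into f1 + f2 - a. Lowering a to f2 keeps v in the cone, and the difference
f1 - a left over is nonnegative: the coordinate at the earlier neighbour r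
is at least a, and r contributes at least its coordinate to f1. *)
Lemma strip_gen_in u w s r u1 u2 :
  uniq u -> descent w s -> strip u w -> u = u1 ++ s :: u2 -> r \in u1 ->
  1 <= edge_coef r s -> strip u (gen C s * w)%g.
Proof.
move=> uu /descentP ds stu uE ru1 krs; apply: cone_strip => // v cv.
apply/inverted_act; have [pv sv dv] := cv.
have := uu; rewrite uE cat_uniq /= negb_or.
case/and4P=> uu1 /andP[s1 /hasPn d12] s2 uu2.
pose f1 := inflow u1 s v; pose f2 := inflow u2 s v; pose a := coord v s.
(* v with its coordinate at s lowered to the least value the cone allows *)
pose rest := v + (f2 - a) *: root s.
have f2_ge0 : 0 <= f2 by apply: inflow_ge0.
have f2a : f2 <= a by apply: dv uE.
have af1 : a <= f1.
  have vr : a <= coord v r.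
    move: ru1 uE uu; case/splitPr=> b1 b2; rewrite -catA /= => uE.
    have := dv _ _ _ uE; rewrite {1}uE cat_uniq /= => vr /and4P[_ _ rn _].
    apply: le_trans vr.
    apply: (le_trans _ (@inflow_ge (b2 ++ s :: u2) r s v _ rn pv)).
      by rewrite edge_coefC; apply: ler_peMr krs; apply: pv.
    by rewrite mem_cat mem_head orbT.
  apply: (le_trans vr); apply: (le_trans _ (inflow_ge ru1 s1 pv)).
  by apply: ler_peMr krs; apply: pv.
have rc t : coord rest t = if t == s then f2 else coord v t.
  rewrite coordD coordZ coord_root; case: eqVneq => [->|_].
    by rewrite mulr1 -/a; ring.
  by rewrite mulr0 addr0.
have -> : act v (gen C s) = rest + (f1 - a) *: root s.
  rewrite act_gen (pairing_supported s uu) // uE inflow_cat inflow_cons.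
  rewrite edge_coef_id -/f1 -/f2 -/a; apply: coordP => t.
  by rewrite !(coordB, coordD, coordN, coordZ); ring.
apply: invertedD; last by apply: invertedZ; rewrite // subr_ge0.
apply: (strip_cone uu stu); split=> [t|t tu|y1 t y2 yE].
- by rewrite rc; case: ifP.
- rewrite rc; case: eqVneq => [ts|_]; last exact: sv.
  by move: tu; rewrite ts uE mem_cat mem_head orbT.
have tn2 : t \notin y2 by move: uu; rewrite yE cat_uniq /= => /and4P[].
rewrite rc; case: eqVneq => [ts|ts].
  move: (yE); rewrite {1}uE ts => /eqP; rewrite uniq_eqseq_pivotl -?uE //.
  by case/andP=> _ /eqP <-; rewrite inflow_addroot.
apply: le_trans (dv _ _ _ yE); rewrite /inflow big_seq [leRHS]big_seq.
apply: ler_sum => x x2; rewrite rc ler_wpM2r //.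
  by apply: edge_coef_ge0; apply: contraNneq tn2 => <-.
by case: eqP => // ->.
Qed.

(** * Initial sets of an oriented diagram *)

Section OrientedDiagram.
Variables (Om : rel S) (hOm : orientation (diagram C) Om).

(** A form of admissibility that is inherited by subwords. *)
Definition ordered (u : seq S) : bool :=
  uniq u && pairwise (fun a b => ~~ Om a b) u.

Lemma orientation_irr s : ~~ Om s s.
Proof. by apply/negP => /hOm.1; rewrite /diagram eqxx. Qed.

Lemma ordered_split u1 s u2 : ordered (u1 ++ s :: u2) ->
  (forall t, t \in u1 -> ~~ Om t s) /\ (forall t, t \in u2 -> ~~ Om s t).
Proof.
case/andP=> _; rewrite pairwise_cat /= => /and3P[/allrelP r12 _ /andP[r2 _]].
split=> t tu; first by apply: r12; rewrite // mem_head.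
exact: (allP r2).
Qed.

Lemma ordered_admissible u : ordered u -> admissible Om [set x in u] u.
Proof.
move=> ou; have /andP[uu _] := ou; apply/andP; split.
  apply: uniq_perm; rewrite ?enum_uniq // => x.
  by rewrite mem_enum inE.
apply/forall_inP => s; rewrite inE => su.
apply/forall_inP => t; rewrite inE => tu.
apply/implyP => st; have ts : t != s.
  by apply: contraTneq st => ->; apply: orientation_irr.
case/splitPr: su ou uu tu => u1 u2 ou uu; rewrite mem_cat inE (negPf ts) /=.
have sn1 : s \notin u1.
  by move: uu; rewrite cat_uniq /= negb_or => /and4P[_ /andP[]].
have [_ r2] := ordered_split ou.
case/orP=> [t1|/r2]; last by rewrite st.
rewrite !index_cat t1 (negPf sn1) /= eqxx addn0.
by rewrite index_mem.
Qed.

Lemma admissible_ordered J u :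
  admissible Om J u -> ordered u /\ J = [set x in u].
Proof.
case/andP=> pu /forall_inP ou.
have uu : uniq u by rewrite (perm_uniq pu) enum_uniq.
have uJ x : (x \in u) = (x \in J) by rewrite (perm_mem pu) mem_enum.
split; last by apply/setP => x; rewrite inE uJ.
rewrite /ordered uu /=; case: u {pu} uu ou uJ => // x0 u uu ou uJ.
apply/(pairwiseP x0) => i j; rewrite !inE => iu ju ij.
apply/negP => Oij.
have inJ k : (k < size (x0 :: u))%N -> nth x0 (x0 :: u) k \in J.
  by move=> ku; rewrite -uJ mem_nth.
have /forall_inP/(_ _ (inJ j ju))/implyP/(_ Oij) := ou _ (inJ i iu).
by rewrite !index_uniq // ltnNge ltnW.
Qed.

Lemma ordered_acyclic u : ordered u -> acyclic Om [set x in u].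
Proof.
move=> /ordered_admissible/andP[_ /forall_inP ou] p p0 pu /andP[cp _].
have [x xp] : exists x, x \in p.
  by case: p p0 {pu cp} => // x p _; exists x; rewrite mem_head.
have [n] := ubnP (index x u); elim: n x xp => // n IHn x xp xn.
have yp : next p x \in p by rewrite mem_next.
apply: (IHn _ yp); rewrite ltnS in xn; apply: leq_trans xn.
have /forall_inP/(_ _ (pu _ yp))/implyP := ou x (pu _ xp); apply.
exact: next_cycle.
Qed.

(** A set listed by an [ordered] word is acyclic, so that cycles disappear from
the arguments; see [initial_setsP]. *)
Definition initial (w : W) (J : {set S}) : Prop :=
  exists u, [/\ ordered u, J = [set x in u] & strip u w].

Lemma initial_setsP w J : initial_sets C w Om J <-> initial w J.
Proof.
split=> [[/admissible_ex[u au]]|[u [ou -> su]]].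
  have [ou ->] := admissible_ordered au.
  rewrite (cox_elt_indep hOm (ordered_admissible ou)) => le.
  by exists u; split=> //; rewrite -weak_le_word //; case/andP: ou.
split; first exact: ordered_acyclic.
rewrite (cox_elt_indep hOm (ordered_admissible ou)).
by have := weak_le_word w (proj1 (andP ou)); rewrite su.
Qed.

(** The admissible ordering may be chosen at will, since the product, and hence
its position in the weak order, does not depend on it. *)
Lemma initial_strip w u : ordered u -> initial w [set x in u] -> strip u w.
Proof.
move=> ou [v [ov uv sv]]; rewrite -weak_le_word; last by case/andP: ou.
have av : admissible Om [set x in u] v by rewrite uv; apply: ordered_admissible.
rewrite /word (admissible_prod hOm (ordered_admissible ou) av).
by have := weak_le_word w (proj1 (andP ov)); rewrite sv.
Qed.

Lemma initial0 w : initial w set0.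
Proof. by exists [::]; split=> //; apply/setP => x; rewrite !inE. Qed.

Definition sink (s : S) (J : {set S}) : bool :=
  (s \in J) && [forall t in J, ~~ Om s t].

Lemma sinkP s (J : {set S}) :
  reflect (s \in J /\ forall t, t \in J -> ~~ Om s t) (sink s J).
Proof.
apply: (iffP andP) => [[sJ /forall_inP h]|[sJ h]]; split=> //.
by apply/forall_inP.
Qed.

Lemma initial_has_sink w J : initial w J -> J != set0 -> exists s, sink s J.
Proof.
move=> [[|s u] [ou -> _]];
  first by move/eqP; case; apply/setP => x; rewrite !inE.
move=> _; exists s; apply/sinkP; split=> [|t]; first by rewrite inE mem_head.
have [_ r2] := @ordered_split [::] s u ou.
by rewrite !inE => /orP[/eqP -> |/r2 //]; apply: orientation_irr.
Qed.

Lemma initial_cons w s J : sink s J -> descent w s ->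
  initial (gen C s * w)%g (J :\ s) -> initial w J.
Proof.
case/sinkP=> sJ sinks ds [u [/andP[uu pu] Ju su]].
have uJ x : (x \in u) = (x != s) && (x \in J).
  by have /setP/(_ x) := Ju; rewrite !inE => <-.
exists (s :: u); split; last by rewrite /= ds.
- rewrite /ordered /= uu pu uJ eqxx /= andbT; apply/allP => t.
  by rewrite uJ => /andP[_]; apply: sinks.
- by apply/setP => x; rewrite !inE uJ; case: eqVneq => // ->.
Qed.

Lemma initial_sink w s J : sink s J -> initial w J ->
  descent w s /\ initial (gen C s * w)%g (J :\ s).
Proof.
case/sinkP=> sJ sinks iJ; have [u [/andP[uu pu] Ju su]] := iJ.
pose v := [seq x <- u | x != s].
have vJ : [set x in v] = J :\ s.
  by rewrite Ju; apply/setP => x; rewrite !inE mem_filter.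
have ov : ordered v by rewrite /ordered filter_uniq // pairwise_filter.
have osv : ordered (s :: v).
  have /andP[uv pv] := ov; rewrite /ordered /= uv pv mem_filter eqxx /= andbT.
  apply/allP => t; rewrite mem_filter => /andP[_ tu]; apply: sinks.
  by rewrite Ju inE.
have svJ : [set x in s :: v] = J.
  by rewrite set_cons vJ setD1K.
have := initial_strip osv; rewrite svJ => /(_ _ iJ) /= /andP[ds sv].
by split=> //; exists v.
Qed.

Lemma initial_gen_notin w s (J : {set S}) :
  descent w s -> s \notin J -> initial w J -> initial (gen C s * w)%g J.
Proof.
move=> ds sJ [u [ou Ju su]]; exists u; split=> //.
apply: strip_gen_notin => //; first by case/andP: ou.
by rewrite Ju inE in sJ.
Qed.

(** The arrow from s to t puts t before s in any admissible word of J, and t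
does not commute with s. *)
Lemma initial_gen_in w s t (J : {set S}) :
  descent w s -> s \in J -> t \in J -> Om s t -> initial w J ->
  initial (gen C s * w)%g J.
Proof.
move=> ds sJ tJ st [u [ou Ju su]]; exists u; split=> //.
have uu : uniq u by case/andP: ou.
move: sJ tJ; rewrite Ju !inE => /path.splitPr uE; case: uE ou su uu => u1 u2.
move=> ou su uu; rewrite mem_cat inE => /or3P[t1|/eqP ts|t2].
- apply: (strip_gen_in uu ds su erefl t1).
  by rewrite edge_coefC; apply: edge_coef_ge1; apply: hOm.1.
- by move: st; rewrite ts (negPf (orientation_irr s)).
by have [_ /(_ t t2)] := ordered_split ou; rewrite st.
Qed.

Lemma initial1 w s : descent w s -> initial w [set s].
Proof.
move=> ds; exists [:: s]; split=> //=; last by rewrite ds.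
by apply/setP => x; rewrite !inE.
Qed.

(** As s and a do not commute and are both descents, w lies above s a s; the
word a s is the admissible ordering of the pair. *)
Lemma initial_edge w s a : descent w s -> descent w a -> Om s a ->
  initial (gen C s * w)%g [set s; a].
Proof.
move=> ds da sa.
have sa' : s != a by apply: contraTneq sa => ->; apply: orientation_irr.
apply: (initial_gen_in ds _ _ sa); rewrite ?inE ?eqxx ?orbT //.
apply: (@initial_cons w a) => //.
  apply/sinkP; split=> [|t]; first by rewrite !inE eqxx orbT.
  have [_ /(_ s a)] := hOm; rewrite sa (hOm.1 _ _ sa) => /(_ isT) /= nas.
  by rewrite !inE => /orP[]/eqP ->; rewrite ?orientation_irr.
have -> : [set s; a] :\ a = [set s].
  apply/setP => x; rewrite !inE.
  by case: (eqVneq x s) => [->|_]; rewrite ?sa' ?andNb ?andbT ?andbN.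
by apply: initial_gen_notin; rewrite ?inE 1?eq_sym //; apply: initial1.
Qed.

(** The restriction to a single new element x leaves little to do when a sink
of Z is outside Y: it is x, so the union is Y with x adjoined, and Z can be
replaced by the singleton of x. *)
Lemma initial_setU w Y Z x : initial w Y -> initial w Z ->
  Z \subset x |: Y -> initial w (Y :|: Z).
Proof.
have [n] := ubnP (len w); elim: n w Y Z x => // n IHn w Y Z x lew.
move=> iY iZ /subsetP Zx.
have IH s : descent w s -> forall Y' Z' x', initial (gen C s * w)%g Y' ->
    initial (gen C s * w)%g Z' -> Z' \subset x' |: Y' ->
    initial (gen C s * w)%g (Y' :|: Z').
  move=> ds Y' Z' x' iY' iZ' sub; apply: IHn iY' iZ' sub.
  by rewrite ltnS in lew; apply: leq_trans lew.
have ZxE b : b \in Z -> b \notin Y -> b = x.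
  by move=> /Zx; rewrite !inE => /orP[/eqP //|->].
(* a sink of the union is stripped from whichever of Y and Z contain it *)
have step b : sink b (Y :|: Z) -> initial w (Y :|: Z).
  move=> sb; have /sinkP[bYZ nb] := sb.
  have sY : b \in Y -> sink b Y.
    by move=> bY; apply/sinkP; split=> // t tY; apply: nb; rewrite inE tY.
  have sZ : b \in Z -> sink b Z.
    by move=> bZ; apply/sinkP; split=> // t tZ; apply: nb; rewrite inE tZ orbT.
  suff [db ib] : descent w b /\ initial (gen C b * w)%g ((Y :|: Z) :\ b).
    exact: initial_cons ib.
  have [bY|bY] := boolP (b \in Y).
    have [db iY'] := initial_sink (sY bY) iY; split=> //; rewrite setDUl.
    apply: (IH b db _ _ x) => //.
      have [bZ|bZ] := boolP (b \in Z); first by case: (initial_sink (sZ bZ) iZ).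
      have -> : Z :\ b = Z.
        by apply/setDidPl; rewrite disjoint_sym disjoints1.
      exact: initial_gen_notin.
    apply/subsetP => t; rewrite !inE => /andP[-> /Zx].
    by rewrite !inE.
  have bZ : b \in Z by move: bYZ; rewrite inE (negPf bY).
  have [db iZ'] := initial_sink (sZ bZ) iZ; split=> //.
  have -> : (Y :|: Z) :\ b = Y; last exact: initial_gen_notin.
  apply/setP => t; rewrite !inE; have [->|tb] := eqVneq t b.
    by rewrite (negPf bY).
  apply: orb_idr => tZ; apply: contraNT tb => /(ZxE _ tZ) ->.
  by rewrite (ZxE _ bZ bY).
(* an initial set is acyclic, hence has a sink *)
have suff_initial w' : initial w' (Y :|: Z) -> initial w (Y :|: Z).
  have [->|YZ0] := eqVneq (Y :|: Z) set0; first by move=> _; apply: initial0.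
  by move=> iYZ; have [b] := initial_has_sink iYZ YZ0; apply: step.
have [->|Z0] := eqVneq Z set0; first by rewrite setU0.
have [a sa] := initial_has_sink iZ Z0; have /sinkP[aZ na] := sa.
have [da iZ'] := initial_sink sa iZ.
have [aY|aY] := boolP (a \in Y).
  have [sYZ|] := boolP (sink a (Y :|: Z)); first exact: step sYZ.
  rewrite /sink inE aY /= => /forall_inPn[t]; rewrite inE => /orP[tY|tZ].
    rewrite negbK => Oat; apply: (suff_initial (gen C a * w)%g).
    have -> : Y :|: Z = Y :|: Z :\ a.
      by apply/setP => z; rewrite !inE; case: eqVneq => // ->; rewrite aY.
    apply: (IH a da _ _ x) => //; first exact: initial_gen_in Oat iY.
    by apply/subsetP => z; rewrite inE => /andP[_ /Zx].
  by rewrite (na t tZ).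
have [->|Y0] := eqVneq Y set0; first by rewrite set0U.
have [s ss] := initial_has_sink iY Y0; have /sinkP[sY ns] := ss.
have YZE : Y :|: Z = a |: Y.
  apply/setP => z; rewrite !inE; have [->|za] := eqVneq z a.
    by rewrite aZ orbT.
  apply: orb_idr => zZ; apply: contraNT za => /(ZxE _ zZ) ->.
  by rewrite (ZxE _ aZ aY).
have [sOa|nsa] := boolP (Om s a); last first.
  apply: (step s); apply/sinkP; split=> [|t]; first by rewrite inE sY.
  by rewrite YZE !inE => /orP[/eqP -> //|]; apply: ns.
have s_a : s != a by apply: contraNneq aY => <-.
have [ds iY'] := initial_sink ss iY.
apply: (suff_initial (gen C s * w)%g).
(* first adjoin a to the rest of Y, then s, each time one element *)
have i1 : initial (gen C s * w)%g (Y :\ s :|: [set a]).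
  apply: (IH s ds _ _ a) => //; last by rewrite subsetUl.
  by apply: initial_gen_notin; rewrite ?inE //; apply: initial1.
have -> : Y :|: Z = (Y :\ s :|: [set a]) :|: [set s; a].
  rewrite YZE; apply/setP => z; rewrite !inE.
  by case: (eqVneq z a); case: (eqVneq z s) => [->|]; rewrite ?sY ?orbT ?orbF.
apply: (IH s ds _ _ s) => //; first exact: initial_edge.
by apply/subsetP => z; rewrite !inE => /orP[->|->]; rewrite ?orbT.
Qed.

End OrientedDiagram.

End Geometric.

(** * The antimatroid *)

Theorem theorem1p8 (W : groupType) (S : finType) (C : coxeterSystem W S)
    (Om : rel S) (hOm : orientation (diagram C) Om) (w : W) :
  antimatroid (initial_sets C w Om).
Proof.
split=> [|Y Z]; first by apply/(initial_setsP hOm); apply: initial0.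
move=> /(initial_setsP hOm) iY /(initial_setsP hOm)[v [ov -> sv]] nsub.
have {nsub} : has [predC Y] v.
  by apply: contraNT nsub; rewrite -all_predC => /allP h; apply/subsetP => x;
    rewrite inE => /h /=; rewrite negbK.
(* the first letter of v outside Y is the element to add *)
move=> hv; case/split_find: hv ov sv => x v1 v2 /= xY; rewrite -all_predC.
move=> /allP v1Y ov; rewrite strip_cat => /andP[sv1 _].
exists x; first by rewrite !inE xY mem_cat mem_rcons mem_head.
apply/(initial_setsP hOm).
have -> : x |: Y = Y :|: [set y in rcons v1 x].
  apply/setP => y; rewrite !inE mem_rcons inE; case: eqVneq => [->|_] /=.
    by rewrite orbT.
  by apply/esym/orb_idr => /v1Y /=; rewrite negbK.
apply: (initial_setU hOm (x := x) iY); last first.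
  apply/subsetP => y; rewrite !inE mem_rcons inE => /orP[->//|/v1Y /=].
  by rewrite negbK orbC => ->.
exists (rcons v1 x); split=> //; move: ov.
rewrite /ordered cat_uniq pairwise_cat.
by case/andP=> /andP[-> _] /and3P[_ -> _].
Qed.
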